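(* Let $G$ be a graph with vertex set $\{1,\dots,n\}$, let $A$ be a real $n\times n$ combinatorially symmetric matrix whose graph is $G$, let $k=\operatorname{rank}(A)$, and let $T=\{v_1,v_2,\ldots,v_{n-k}\}$ be a minimum transversal of $\mathcal{F}_A$ (with $v_1,\dots,v_{n-k}$ distinct). For each $v_i\in T$ let $F_{v_i}$ be the unique set in $\mathcal{F}_A$ that contains no element of $T$ other than $v_i$. Then there exists a basis of $\operatorname{Nul}(A)$ of the form $X=\{x_1,x_2,\ldots,x_{n-k}\}$ such that $\operatorname{supp}(x_i)=F_{v_i}$ for $1\leq i\leq n-k$.
   Context: Graphs are finite and simple. A real $n\times n$ matrix $A=[a_{ij}]$ is combinatorially symmetric if $a_{ij}\neq 0$ if and only if $a_{ji}\neq 0$. The graph of such an $A$ has vertex set $\{1,\dots,n\}$ and edges $\{ij : i\neq j,\ a_{ij}\neq 0\}$ (the diagonal entries of $A$ are unrestricted). $\operatorname{Nul}(A)$ is the null space of $A$. The support of $x=(x_i)\in\mathbb{R}^n$ is $\operatorname{supp}(x)=\{i : x_i\neq 0\}$. Define $\mathcal{F}_A = \{\operatorname{supp}(x) : x\in\operatorname{Nul}(A),\ x\neq 0\}$. A transversal of a collection $\mathcal{S}$ of subsets of $\{1,\dots,n\}$ is a set $T\subseteq\{1,\dots,n\}$ with $T\cap S\neq\emptyset$ for all $S\in\mathcal{S}$; it is minimum if it has the smallest possible cardinality. For a minimum transversal $T$ of $\mathcal{F}_A$, it is known that $|T| = n-\operatorname{rank}(A)$ and that for each $v\in T$ there is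 exactly one set $F_v\in\mathcal{F}_A$ containing no element of $T$ other than $v$. *)

(* Defs.v *)
From HB Require Import structures.
From mathcomp Require Import all_boot all_order all_algebra boolp reals.

Set Implicit Arguments.
Unset Strict Implicit.
Unset Printing Implicit Defensive.

Import GRing.Theory.
Local Open Scope ring_scope.

Definition simple_graph (V : finType) (G : rel V) : Prop :=
  symmetric G /\ irreflexive G.

Definition comb_symmetric (F : fieldType) (n : nat) (A : 'M[F]_n) : Prop :=
  forall i j, A i j != 0 <-> A j i != 0.

Definition matrix_graph (F : fieldType) (n : nat) (A : 'M[F]_n) : rel 'I_n :=
  fun i j => (i != j) && (A i j != 0).

(* Vectors are columns: this is [{x | A *m x = 0}] (see [mem_nul]), whereas
   [kermx A] would be the left kernel. *)
Definition nul (F : fieldType) (n : nat) (A : 'M[F]_n) : {vspace 'cV[F]_n} :=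
  lker (linfun (mulmx A)).

Lemma mem_nul (F : fieldType) (n : nat) (A : 'M[F]_n) (x : 'cV[F]_n) :
  (x \in nul A) = (A *m x == 0).
Proof. by rewrite memv_ker lfunE. Qed.

Definition supp (F : fieldType) (n : nat) (x : 'cV[F]_n) : {set 'I_n} :=
  [set i | x i 0 != 0].

Definition nul_supports (F : fieldType) (n : nat) (A : 'M[F]_n)
    (S : {set 'I_n}) : Prop :=
  exists x : 'cV[F]_n, [/\ x \in nul A, x != 0 & S = supp x].

Definition transversal (V : finType) (C : {set V} -> Prop) (T : {set V}) : Prop :=
  forall S, C S -> T :&: S != set0.

Definition min_transversal (V : finType) (C : {set V} -> Prop) (T : {set V}) : Prop :=
  transversal C T /\ forall T', transversal C T' -> (#|T| <= #|T'|)%N.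

Definition only_meets_at (V : finType) (C : {set V} -> Prop) (T : {set V})
    (v : V) (S : {set V}) : Prop :=
  C S /\ forall u, u \in T -> u \in S -> u = v.

(* Hence the sets F_v attached to a minimum transversal are well defined. *)
Lemma only_meets_at_unique (F : fieldType) (n : nat) (A : 'M[F]_n)
    (T : {set 'I_n}) (v : 'I_n) :
  min_transversal (nul_supports A) T -> v \in T ->
  exists! S, only_meets_at (nul_supports A) T v S.
Proof.
move=> [trT minT] vT.
have key (x y : 'cV[F]_n) : x \in nul A -> y \in nul A ->
    (forall u, u \in T -> u \in supp x -> u = v) ->
    (forall u, u \in T -> u \in supp y -> u = v) ->
    y v 0 *: x = x v 0 *: y.
  move=> Nx Ny hx hy; apply/eqP; rewrite -subr_eq0; apply/negPn/negP => z0.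
  have /set0Pn[u] : T :&: supp (y v 0 *: x - x v 0 *: y) != set0.
    by apply: trT; eexists; split; [|exact: z0|]; rewrite ?memvB ?memvZ.
  rewrite !inE !mxE => /andP[uT].
  have [->|neuv] := eqVneq u v; first by rewrite mulrC subrr eqxx.
  have x0 : x u 0 = 0.
    by apply/eqP/negPn/negP => h; case/eqP: neuv; apply: hx; rewrite ?inE.
  have y0 : y u 0 = 0.
    by apply/eqP/negPn/negP => h; case/eqP: neuv; apply: hy; rewrite ?inE.
  by rewrite x0 y0 !mulr0 subrr eqxx.
have meet (x : 'cV[F]_n) : x \in nul A -> x != 0 ->
    (forall u, u \in T -> u \in supp x -> u = v) -> x v 0 != 0.
  move=> Nx x0 hx; have /set0Pn[u] : T :&: supp x != set0.
    by apply: trT; exists x.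
  by rewrite in_setI => /andP[uT ux]; move: (ux); rewrite (hx u uT ux) inE.
have uniqS S S' : only_meets_at (nul_supports A) T v S ->
    only_meets_at (nul_supports A) T v S' -> S = S'.
  move=> [[x [Nx x0 ->]] hx] [[y [Ny y0 ->]] hy].
  have := key x y Nx Ny hx hy => e; apply/setP=> i; rewrite !inE.
  have /(congr1 (fun B : 'cV_n => B i 0 == 0)) := e.
  rewrite !mxE !mulf_eq0 (negPf (meet x Nx x0 hx)) (negPf (meet y Ny y0 hy)) /=.
  by move=> ->.
have [[S hS]|nS] := pselect
  (exists S, only_meets_at (nul_supports A) T v S).
  by exists S; split=> [|S' hS']; [exact: hS|exact: uniqS].
have : transversal (nul_supports A) (T :\ v).
  move=> S CS; apply/negP => /eqP e; apply: nS; exists S; split=> // u uT uS.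
  apply/eqP/negPn/negP => neuv.
  have : u \in (T :\ v) :&: S by rewrite !inE neuv uT.
  by rewrite e inE.
by move/minT; rewrite (cardsD1 v T) vT ltnn.
Qed.

(* Main.v *)
Require Import Defs.
From mathcomp Require Import all_boot all_order all_algebra boolp reals.

Import GRing.Theory.
Local Open Scope ring_scope.

(** A null vector that vanishes on a transversal [T] of the supports is zero,
    since otherwise its support would have to meet [T]: restriction to the
    coordinates in [T] is injective on the null space
    ([nul_eq0_of_transversal]).  A null vector [x_i] with support [F (v i)] is
    therefore nonzero at some element of [T], which can only be [v i], and it
    vanishes at every other [v j].  So the restrictions of the [x_i] to [T] form
    an invertible diagonal matrix.  Diagonality makes the [x_i] independent, and
    it allows any null vector to be matched on [T] by a combination of them,
    which is then equal to it by injectivity ([basis_of_diagonal_coords]).  The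
    spanning property is thus obtained without computing the dimension of the
    null space. *)

Lemma nul_eq0_of_transversal {F : fieldType} {n : nat} {A : 'M[F]_n}
    {T : {set 'I_n}} {x : 'cV[F]_n} :
  Defs.transversal (nul_supports A) T -> x \in nul A ->
  (forall u, u \in T -> x u 0 = 0) -> x = 0.
Proof.
move=> trT Nx xT0; apply/eqP/negPn/negP => x_neq0.
have /set0Pn[u] : T :&: supp x != set0 by apply: trT; exists x.
by rewrite !inE => /andP[/xT0 ->]; rewrite eqxx.
Qed.

(** If the coordinates [v] determine the vectors of [U], then a family in [U]
    whose matrix of [v]-coordinates is diagonal and invertible is a basis: the
    coefficient of a vector on [X_i] is read off from its coordinate [v i]. *)
Lemma basis_of_diagonal_coords {F : fieldType} {m n : nat}
    {U : {vspace 'cV[F]_n}} {v : 'I_m -> 'I_n} {X : m.-tuple 'cV[F]_n} :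
  (forall x, x \in U -> (forall i, x (v i) 0 = 0) -> x = 0) ->
  (forall i, tnth X i \in U) ->
  (forall i, tnth X i (v i) 0 != 0) ->
  (forall i j, j != i -> tnth X i (v j) 0 = 0) ->
  basis_of U X.
Proof.
move=> Uinj XU Xdiag Xoff.
have coord_sum (k : 'I_m -> F) i :
    (\sum_j k j *: tnth X j) (v i) 0 = k i * tnth X i (v i) 0.
  rewrite summxE (bigD1 i) //= mxE big1 ?addr0 // => j ji.
  by rewrite mxE Xoff ?mulr0 // eq_sym.
apply/andP; split.
  rewrite eqEsubv; apply/andP; split.
    by apply/span_subvP => x /tnthP[i ->].
  apply/subvP => y Uy.
  pose z := \sum_i (y (v i) 0 / tnth X i (v i) 0) *: tnth X i.
  have -> : y = z.
    apply/eqP; rewrite -subr_eq0; apply/eqP/Uinj.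
      by rewrite memvB // memv_suml // => i _; rewrite memvZ.
    by move=> i; rewrite 2!mxE coord_sum divfK // subrr.
  by rewrite memv_suml // => i _; rewrite memvZ // memv_span // mem_tnth.
apply/freeP => k kX0 i.
have : (\sum_j k j *: tnth X j) (v i) 0 = 0.
  under eq_bigr do rewrite (tnth_nth 0).
  by rewrite kX0 mxE.
by rewrite coord_sum => /eqP; rewrite mulf_eq0 (negPf (Xdiag i)) orbF => /eqP.
Qed.

Theorem proposition3p5 (R : realType) (n : nat) (G : rel 'I_n) (A : 'M[R]_n)
    (hG : simple_graph G)
    (hA : comb_symmetric A)
    (hGA : forall i j, G i j = matrix_graph A i j)
    (T : {set 'I_n})
    (hT : min_transversal (nul_supports A) T)
    (v : 'I_(n - \rank A) -> 'I_n)
    (v_inj : injective v)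
    (hTv : T = [set v i | i : 'I_(n - \rank A)])
    (F : 'I_n -> {set 'I_n})
    (hF : forall u, u \in T ->
            unique (only_meets_at (nul_supports A) T u) (F u)) :
  exists X : (n - \rank A).-tuple 'cV[R]_n,
    basis_of (nul A) X /\
    forall i : 'I_(n - \rank A), supp (tnth X i) = F (v i).
Proof.
have [trT _] := hT.
have vT i : v i \in T by rewrite hTv imset_f.
have exx i : exists x : 'cV[R]_n, [/\ x \in nul A, x != 0 & F (v i) = supp x].
  by have [[]] := hF (v i) (vT i).
have [x xP] := choice exx.
have xoff i u : u \in T -> u != v i -> x i u 0 = 0.
  move=> uT; apply: contra_neq_eq => xu; have [_ _ Fx] := xP i.
  by have [[_ only] _] := hF (v i) (vT i); apply: only; rewrite // Fx inE.
exists [tuple x i | i < n - \rank A]; split; last first.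
  by move=> i; rewrite tnth_mktuple; have [_ _ ->] := xP i.
apply: (@basis_of_diagonal_coords _ _ _ _ v).
- move=> y Ny yv0; apply: (nul_eq0_of_transversal trT Ny) => u.
  by rewrite hTv => /imsetP[i _ ->].
- by move=> i; rewrite tnth_mktuple; have [] := xP i.
- move=> i; rewrite tnth_mktuple; have [Nx + _] := xP i.
  apply: contra_neq => xv0; apply: (nul_eq0_of_transversal trT Nx) => u uT.
  by have [->//|] := eqVneq u (v i); apply: xoff.
- by move=> i j ji; rewrite tnth_mktuple xoff // inj_eq.
Qed.
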